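(* Let $n,N\ge1$ be integers with $n\le10^{-4}N^{4/5}$. Then for every $\sigma\in S_n$ with $|\sigma|\ge4$, $$\log\left(\frac{N^{n+|\sigma|}\,|\mathrm{Wg}_N^{\mathrm U}(\sigma)|}{|\mathrm{Moeb}(\sigma)|}\right)\le 25\,\frac{n^{5/2}}{N^2}\,|\sigma|+\log|\sigma|+2.$$
   Context: $S_n$ is the group of permutations of $[n]=\{1,\dots,n\}$, and $S_0:=\{\varnothing\}$. For $\sigma\in S_n$ with $l$ cycles (fixed points count as cycles of length 1), $|\sigma|:=n-l$. $\mathrm{Cat}(k)=\frac{(2k)!}{k!(k+1)!}$. If the cycles of $\sigma$ have lengths $C_1,\dots,C_l$, then $\mathrm{Moeb}(\sigma):=(-1)^{|\sigma|}\prod_{i=1}^l \mathrm{Cat}(C_i-1)$. $\log$ is the natural logarithm. Unitary Weingarten graph: the directed graph with vertex set $\bigsqcup_{n\ge 0}S_n$ and two kinds of edges. For $\sigma,\sigma'\in S_n$ there is a solid edge $\sigma\to\sigma'$ if $\sigma'=(i\; n)\sigma$ for some $1\le i\le n-1$. If $\sigma\in S_n$ ($n\ge1$) fixes $n$, there is a dashed edge $\sigma\to\sigma|_{[n-1]}\in S_{n-1}$. $\mathrm P(\sigma,l)$ is the set of directed paths from $\sigma$ to $\varnothing$ using exactly $l$ solid edges. Unitary Weingarten function: for $n\le N$ and $\sigma\in S_n$, $$\mathrm{Wg}^{\mathrm U}_N(\sigma)=(-1)^{|\sigma|}N^{-n-|\sigma|}\sum_{g=0}^\infty |\mathrm P(\sigma,|\sigma|+2g)|\,N^{-2g}$$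 (a convergent series). *)

(* Defs.v *)
From mathcomp Require Import all_boot all_order all_algebra all_fingroup.
From mathcomp Require Import finmap.
From mathcomp Require Import all_classical all_reals all_analysis.
Import Order.TTheory GRing.Theory Num.Theory.
Import numFieldNormedType.Exports.

Set Implicit Arguments.
Unset Strict Implicit.
Unset Printing Implicit Defensive.

Local Open Scope classical_set_scope.
Local Open Scope ring_scope.

(* [n] = {1, .., n} is modelled by 'I_n = {0, .., n - 1}; the letter n of
   S_n is therefore the last element [ord_max] of 'I_n, and [lift ord_max]
   is the inclusion of [n - 1] into [n]. *)

(* [porbits s] is the set of supports of the cycles of s, fixed points
   included. *)
Definition perm_length (n : nat) (s : 'S_n) : nat := (n - #|porbits s|)%N.

Section Moeb.
Variable R : realType.

Definition Cat (k : nat) : R := (2 * k)%N`!%:R / (k`!%:R * k.+1`!%:R).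

Definition Moeb (n : nat) (s : 'S_n) : R :=
  (-1) ^+ perm_length s * \prod_(C in porbits s) Cat (#|C| - 1)%N.

End Moeb.

Definition vertex : Type := {n : nat & 'S_n}.

Definition vtx (n : nat) (s : 'S_n) : vertex := existT (fun n => 'S_n) n s.

Definition empty_vertex : vertex := @vtx 0 1%g.

(* Products in MathComp compose from left to right: the permutation
   [s * tperm i n] maps x to (i n)(s(x)), i.e. it is (i n)s in the usual
   right-to-left notation. *)
Definition solid_edge (u v : vertex) : bool :=
  let: existT n s := u in
  match n return 'S_n -> bool with
  | 0 => fun=> false
  | n'.+1 => fun s : 'S_n'.+1 =>
      [exists i : 'I_n', v == vtx (s * tperm (lift ord_max i) ord_max)%g]
  end s.

Definition dashed_edge (u v : vertex) : bool :=
  let: existT n s := u in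
  match n return 'S_n -> bool with
  | 0 => fun=> false
  | n'.+1 => fun s : 'S_n'.+1 =>
      (s ord_max == ord_max) &&
      [exists t : 'S_n', (v == vtx t) &&
         [forall i : 'I_n', s (lift ord_max i) == lift ord_max (t i)]]
  end s.

Definition edge (u v : vertex) : bool := solid_edge u v || dashed_edge u v.

Definition solid_count (u : vertex) (p : seq vertex) : nat :=
  count id (pairmap solid_edge u p).

(* There is at most one edge, solid or dashed, from a vertex to another one
   (see [solid_edge_inj], [solid_dashedF]), so that a path is determined by
   the sequence of its vertices; the initial vertex s is left out. *)
Definition wpaths (n : nat) (s : 'S_n) (l : nat) : set (seq vertex) :=
  [set p | [/\ path edge (vtx s) p, last (vtx s) p = empty_vertex
             & solid_count (vtx s) p = l]].

(* [fset_set] is meaningful on finite sets only; see [finite_wpaths]. *)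
Definition num_wpaths (n : nat) (s : 'S_n) (l : nat) : nat :=
  #|` fset_set (wpaths s l)|%N.

(* The series converges for n <= N, the only range in which this is meant. *)
Definition WgU (R : realType) (N n : nat) (s : 'S_n) : R :=
  (-1) ^+ perm_length s * N%:R ^- (n + perm_length s)%N *
  limn (series (fun g : nat =>
    (num_wpaths s (perm_length s + 2 * g)%N)%:R * N%:R ^- (2 * g)%N : R)).

Lemma solid_edge_inj (n : nat) (s : 'S_n.+1) (i j : 'I_n) :
  (s * tperm (lift ord_max i) ord_max)%g =
  (s * tperm (lift ord_max j) ord_max)%g -> i = j.
Proof.
move=> /mulgI /permP /(_ ord_max); rewrite !tpermR; exact: lift_inj.
Qed.

Lemma solid_edge_tag (u v : vertex) : solid_edge u v -> tag v = tag u.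
Proof.
by case: u => -[|n] s //= /existsP[i /eqP ->].
Qed.

Lemma dashed_edge_tag (u v : vertex) : dashed_edge u v -> (tag v).+1 = tag u.
Proof.
by case: u => -[|n] s //= /andP[_ /existsP[t /andP[/eqP -> _]]].
Qed.

Lemma solid_dashedF (u v : vertex) : ~~ (solid_edge u v && dashed_edge u v).
Proof.
apply/negP => /andP[/solid_edge_tag e /dashed_edge_tag].
by rewrite e => /eqP; rewrite eqn_leq ltnn.
Qed.

Lemma size_path_edge (u : vertex) (p : seq vertex) : path edge u p ->
  (size p + tag (last u p) = tag u + solid_count u p)%N.
Proof.
rewrite /solid_count; elim: p u => [|v p IH] u /=; first by rewrite addn0.
move=> /andP[uv /IH {}IH]; rewrite addSn IH; move: uv; rewrite /edge.
case: (boolP (solid_edge u v)) => [/solid_edge_tag -> _ | _ /dashed_edge_tag <-].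
  by rewrite /= add1n addnS.
by rewrite /= add0n addSn.
Qed.

Lemma finite_succ (u : vertex) : finite_set [set v | edge u v].
Proof.
case: u => -[|n] s; first by apply: (@sub_finite_set _ _ set0).
apply: (@sub_finite_set _ _
  ((range (fun i : 'I_n => vtx (s * tperm (lift ord_max i) ord_max)%g)) `|`
   (range (fun t : 'S_n => vtx t)))).
  move=> v /orP[/existsP[i /eqP ->]|/andP[_ /existsP[t /andP[/eqP -> _]]]].
    by left; exists i.
  by right; exists t.
by rewrite finite_setU; split; apply: finite_image; exact: finite_finset.
Qed.

Lemma finite_paths_size (k : nat) (u : vertex) :
  finite_set [set p | path edge u p /\ size p = k].
Proof.
elim: k u => [|k IH] u.
  apply: (@sub_finite_set _ _ [set [::]]); last exact: finite_set1.
  by move=> p [_ /size0nil ->].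
apply: (@sub_finite_set _ _ (\bigcup_(v in [set v | edge u v])
   (cons v @` [set p | path edge v p /\ size p = k]))).
  move=> [|v p] [] //= /andP[uv vp] [sp]; exists v => //.
  by exists p.
apply: bigcup_finite; first exact: finite_succ.
by move=> v _; apply: finite_image.
Qed.

Lemma finite_wpaths (n : nat) (s : 'S_n) (l : nat) : finite_set (wpaths s l).
Proof.
apply: sub_finite_set (finite_paths_size (n + l) (vtx s)) => p [sp lp cp].
by split=> //; have := size_path_edge sp; rewrite lp cp addn0.
Qed.

(* Main.v *)
(* Put x = 1/N. Splitting off the first edge of a path shows that the generating
   series W of the paths starting at s, with weight x per solid edge, is
   dominated by every nonnegative F with F(empty) >= 1 and, on S_m,
     F(s) >= x \sum_i F((i m) s) + [s(m) = m] F(s restricted to [m-1]).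
   We take F(s) = (x q)^|s| |Moeb(s)| D^m for m <= n. Write a for the
   length of the cycle of the last letter m. The transpositions (i m) that cut this
   cycle contribute exactly F(s) / q by Segner's recurrence for the Catalan
   numbers. One that merges it with a cycle of length b multiplies |Moeb| by
   Cat(a+b-1) / (Cat(a-1) Cat(b-1)) <= 8 a^(3/2), so all the merges together
   contribute at most 8 n a^(3/2) x^2 q F(s). When the last letter is fixed, a = 1
   and the factor D absorbs them. With L = n^(5/2) / N^2 small, the
   inequality for F holds with q = 1 + 25 L and D = 1 + 10 n / N^2, and
   q^|s| D^n <= exp (25 L |s| + 1). *)
Require Import Defs.
From mathcomp Require Import all_boot all_order all_algebra all_fingroup.
From mathcomp Require Import finmap.
From mathcomp Require Import all_classical all_reals all_analysis.
From mathcomp Require Import ring lra zify.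
Import Order.TTheory GRing.Theory Num.Theory.
Import numFieldNormedType.Exports.
Local Open Scope ring_scope.

Set Implicit Arguments.
Unset Strict Implicit.
Unset Printing Implicit Defensive.

(** * Cutting a cycle of a permutation *)

Lemma eq_in_porbit (T : finType) (s t : {perm T}) (z : T) :
  {in porbit s z, t =1 s} -> porbit t z = porbit s z.
Proof.
move=> ts.
have e i : (t ^+ i)%g z = (s ^+ i)%g z.
  elim: i => [|i IH]; first by rewrite !expg0 !perm1.
  by rewrite !expgSr !permM IH ts // mem_porbit.
by apply/setP => u; apply/porbitP/porbitP => -[i ->]; exists i; rewrite e.
Qed.

(** Here [k] is any positive period, not necessarily the least one: exponents are reduced modulo
    [k]. *)
Lemma porbit_traject_iter (T : finType) (s : {perm T}) (y : T) (k : nat) :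
  (0 < k)%N -> iter k s y = y -> porbit s y =i traject s y k.
Proof.
move=> k0 sk u; apply/porbitP/trajectP => [[i ->]|[i _ ->]]; last first.
  by exists i; rewrite permX.
exists (i %% k)%N; first by rewrite ltn_mod.
rewrite permX [in LHS](divn_eq i k) addnC iterD; congr iter.
by elim: (i %/ k)%N => // j IH; rewrite mulSn iterD IH.
Qed.

Lemma iter_porbit_inj (T : finType) (s : {perm T}) (y : T) (i j : nat) :
  (i < #|porbit s y|)%N -> (j < #|porbit s y|)%N ->
  iter i s y = iter j s y -> i = j.
Proof.
move=> ia ja e; have := @nth_uniq _ y (traject s y #|porbit s y|) i j.
rewrite size_traject !nth_traject // e eqxx => /(_ ia ja).
by move=> /(_ (uniq_traject_porbit s y)) /esym /eqP.
Qed.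

Section CutCycle.
Variables (T : finType) (s : {perm T}) (y : T) (k : nat).
Hypotheses (k_gt0 : (0 < k)%N) (k_lt : (k < #|porbit s y|)%N).

Let x := iter k s y.
Let t : {perm T} := (s * tperm x y)%g.

(** Before step [k] the [s]-trajectory of [y] reaches neither [x] nor, after its start, [y], so the
    transposition does not act. *)
Lemma iter_cut (j : nat) : (j < k)%N -> iter j t y = iter j s y.
Proof.
elim: j => // j IH jk; rewrite !iterS IH ?(ltnW jk) // permM tpermD //.
  by apply/eqP; rewrite -iterS => /iter_porbit_inj; lia.
apply/eqP; rewrite -iterS => /(@iter_porbit_inj _ s y 0); lia.
Qed.

Lemma porbit_cut : porbit t y =i traject s y k.
Proof.
have e : traject t y k = traject s y k.
  apply: (@eq_from_nth _ y); rewrite !size_traject // => j jk.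
  by rewrite !nth_traject // iter_cut.
rewrite -e; apply: porbit_traject_iter => //.
(* At step [k], where [s] would reach [x], the transposition sends the trajectory back to [y]. *)
by rewrite -(prednK k_gt0) iterS iter_cut ?prednK // permM -iterS prednK // tpermL.
Qed.

Lemma card_porbit_cut : #|porbit t y| = k.
Proof.
rewrite (eq_card porbit_cut) (card_uniqP _) ?size_traject //.
have := uniq_traject_porbit s y; rewrite -(subnKC (ltnW k_lt)) trajectD cat_uniq.
by case/andP.
Qed.

End CutCycle.

Lemma iter_porbit_sub (T : finType) (s : {perm T}) (y : T) (k : nat) :
  (k <= #|porbit s y|)%N -> iter (#|porbit s y| - k) s (iter k s y) = y.
Proof. by move=> ka; rewrite -iterD subnK // iter_porbit. Qed.

(** The transposition is symmetric, so the second piece comes from [porbit_cut] started at [x], from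
    which [y] is reached after the remaining steps. The non-membership clauses let cardinals and
    products over cycles split. *)
Lemma porbits_cut (T : finType) (s : {perm T}) (y : T) (k : nat)
    (x := iter k s y) (t := (s * tperm x y)%g) :
  (0 < k)%N -> (k < #|porbit s y|)%N ->
  [/\ #|porbit t y| = k, #|porbit t x| = (#|porbit s y| - k)%N,
      porbits t = porbit t y |: (porbit t x |: (porbits s :\ porbit s y)),
      porbit t y \notin porbit t x |: (porbits s :\ porbit s y) &
      porbit t x \notin porbits s :\ porbit s y].
Proof.
move=> k0 ka.
have Px : porbit s x = porbit s y.
  by rewrite /x -permX porbit_perm.
have xk : iter (#|porbit s y| - k) s x = y by rewrite iter_porbit_sub // ltnW.
have tE : t = (s * tperm y x)%g by rewrite tpermC.
have cy := porbit_cut k0 ka.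
have cx : porbit t x =i traject s x (#|porbit s y| - k).
  rewrite tE -{1}xk; apply: porbit_cut; first by rewrite subn_gt0.
  by rewrite Px; lia.
have ny : #|porbit t y| = k by exact: card_porbit_cut.
have nx : #|porbit t x| = (#|porbit s y| - k)%N.
  rewrite tE -{1}xk; apply: card_porbit_cut; first by rewrite subn_gt0.
  by rewrite Px; lia.
have U z : (z \in porbit s y) = (z \in porbit t y) || (z \in porbit t x).
  by rewrite cx cy porbit_traject -{1}(subnKC (ltnW ka)) trajectD mem_cat.
(* Outside the cycle of [y], [s] never takes the values [x] and [y], so [t] agrees with it. *)
have D z : z \notin porbit s y -> porbit t z = porbit s z.
  move=> zy; apply: eq_in_porbit => w wz; rewrite /t permM tpermD //.
    apply: contraNneq zy => e; rewrite -eq_porbit_mem -Px e.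
    by rewrite -[s w]/((s ^+ 1)%g w) porbit_perm eq_sym eq_porbit_mem.
  apply: contraNneq zy => e; rewrite -eq_porbit_mem e.
  by rewrite -[s w]/((s ^+ 1)%g w) porbit_perm eq_sym eq_porbit_mem.
have N z : z \in porbit s y -> forall C, C \in porbits s :\ porbit s y ->
    porbit t z != C.
  move=> zy C; rewrite !inE => /andP[Cy /imsetP[w _ Cw]].
  apply: contraNneq Cy => e; rewrite Cw eq_porbit_mem.
  have zC : z \in porbit s w by rewrite -Cw -e porbit_id.
  move: zC; rewrite -eq_porbit_mem => /eqP zw.
  by rewrite porbit_sym -zw (eqP (_ : porbit s z == porbit s y)) ?eq_porbit_mem //
    porbit_id.
split=> //.
- apply/setP => C; apply/imsetP/idP => [[z _ ->]|].
    rewrite !inE; case: (boolP (z \in porbit s y)).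
      by rewrite U -!eq_porbit_mem => /orP[] -> //; rewrite orbT.
    move=> zy; rewrite (D z zy) imset_f // andbT.
    by rewrite (eq_porbit_mem s z y) zy !orbT.
  rewrite !inE => /orP[/eqP ->|/orP[/eqP ->|]]; [by exists y|by exists x|].
  move=> /andP[Cy /imsetP[z _ Cz]]; exists z => //; rewrite Cz D //.
  by rewrite -eq_porbit_mem -Cz.
- rewrite 2!inE negb_or; apply/andP; split; last first.
    by apply/negP => /(N y (porbit_id s y)); rewrite eqxx.
  rewrite eq_porbit_mem cx; apply/trajectP => -[j jk /eqP]; apply/negP.
  rewrite -iterD -[X in X != _]/(iter 0 s y); apply/eqP => /iter_porbit_inj; lia.
- apply/negP => /(N x); rewrite eqxx U porbit_id orbT => /(_ isT) //.
Qed.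

(** * Catalan numbers *)

Section CatalanRecurrence.
Variables (R : realFieldType) (c : nat -> R).
Hypotheses (c_gt0 : forall k, 0 < c k) (c_0 : c 0%N = 1).
Hypothesis c_rec :
  forall k, (k%:R + 2) * c k.+1 = 2 * (2 * k%:R + 1) * c k.
Implicit Types k m : nat.

(** The ratio of consecutive terms is (4k + 2) / (k + 2), which is below 4. *)
Lemma catalanS_le k : c k.+1 <= 4 * c k.
Proof.
have k0 : 0 <= k%:R :> R by [].
rewrite -(@ler_pM2l _ (k%:R + 2)); last by lra.
by rewrite c_rec [leRHS]mulrA ler_pM2r ?c_gt0 //; lra.
Qed.

Lemma catalanD_le k j : c (k + j) <= 4 ^+ j * c k.
Proof.
elim: j => [|j IH]; first by rewrite addn0 mul1r.
by rewrite addnS exprS -mulrA (le_trans (catalanS_le _)) // ler_pM2l.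
Qed.

Let conv m := \sum_(i < m.+1) c i * c (m - i).

(** The products are symmetric under i <-> m - i, and the weights i and m - i add up to m. *)
Lemma convolution_sum_rev m :
  2 * \sum_(i < m.+1) i%:R * (c i * c (m - i)) = m%:R * conv m.
Proof.
rewrite mulr_natl mulr2n {2}(reindex_inj rev_ord_inj) -big_split /= mulr_sumr.
apply: eq_bigr => i _; have im : (i <= m)%N by rewrite -ltnS.
by rewrite subSS subKn // natrB // [X in _ + _ * X]mulrC -mulrDl addrC subrK.
Qed.

(* Summing [c_rec] against [c (m - i)] and symmetrizing [i <-> m - i]
   gives [(m + 3) conv (m + 1) - 2 Cat (m + 1) = 4 (m + 1) conv m]. *)
Lemma catalan_convolution m : \sum_(i < m.+1) c i * c (m - i) = c m.+1.
Proof.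
elim: m => [|m IH].
  rewrite big_ord1 subn0 c_0; have := c_rec 0; rewrite c_0; lra.
rewrite -/(conv m.+1); rewrite -/(conv m) in IH.
have e1 : \sum_(i < m.+1) (i%:R + 2) * (c i.+1 * c (m - i)) =
          2 * (m%:R + 1) * conv m.
  have -> : 2 * (m%:R + 1) * conv m = 2 * (m%:R * conv m) + 2 * conv m by ring.
  rewrite -convolution_sum_rev 2!mulr_sumr mulr_sumr -big_split /=.
  by apply: eq_bigr => i _; rewrite mulrA c_rec; ring.
(* Shift the index to j = i + 1, so that i + 2 = j + 1; the added [c m.+1] is the term j = 0. *)
have e2 : \sum_(i < m.+1) (i%:R + 2) * (c i.+1 * c (m - i)) + c m.+1 =
  \sum_(i < m.+2) i%:R * (c i * c (m.+1 - i)) + conv m.+1.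
  rewrite /conv -big_split /= [RHS]big_ord_recl /= subn0 c_0 addrC; congr (_ + _).
    by apply: eq_bigr => i _; rewrite /bump /= add1n subSS -natr1; ring.
  by rewrite mul0r add0r mul1r.
have e3 := convolution_sum_rev m.+1.
have r := c_rec m.+1.
rewrite IH in e1.
have m0 : 0 <= m%:R :> R by [].
apply: (@mulfI _ (m%:R + 3)); first by apply/eqP; lra.
rewrite -[m.+1%:R]natr1 in e3 r.
have -> : (m%:R + 3) * c m.+2 = (m%:R + 1 + 2) * c m.+2 by ring.
rewrite r.
have -> : (m%:R + 3) * conv m.+1 = (m%:R + 1) * conv m.+1 + 2 * conv m.+1 by ring.
rewrite -e3; move: e2; rewrite e1.
set S := \sum_(i < m.+2) _ => e2; nra.
Qed.

(** [(m + 1) * c m] is the central binomial coefficient, and this is its lower bound 4^m / sqrt (4m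
    + 1) in squared form. The induction step leaves the surplus [4 * c m ^+ 2]. *)
Lemma exp16_le_catalan m : 16 ^+ m <= (4 * m%:R + 1) * ((m%:R + 1) * c m) ^+ 2.
Proof.
elim: m => [|m IH]; first by rewrite c_0 expr0; lra.
have m0 : 0 <= m%:R :> R by [].
have -> : (m.+1%:R + 1) * c m.+1 = 2 * (2 * m%:R + 1) * c m.
  by rewrite -c_rec -natr1; ring.
rewrite exprS (@le_trans _ _ (16 * ((4 * m%:R + 1) * ((m%:R + 1) * c m) ^+ 2))) //.
  by rewrite ler_pM2l.
have -> : (4 * m.+1%:R + 1) * (2 * (2 * m%:R + 1) * c m) ^+ 2 =
    16 * ((4 * m%:R + 1) * ((m%:R + 1) * c m) ^+ 2) + 4 * c m ^+ 2.
  by rewrite -[m.+1%:R]natr1; ring.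
by rewrite lerDl mulr_ge0 ?sqr_ge0.
Qed.

(** Square root of the previous bound. Any upper bound [r] of sqrt (m + 1) is allowed, so that one
    [r] can serve all cycles. *)
Lemma exp4_le_catalan m (r : R) : 0 <= r -> m.+1%:R <= r ^+ 2 ->
  4 ^+ m <= 2 * r * m.+1%:R * c m.
Proof.
move=> r0 mr; have m0 : 0 <= m%:R :> R by [].
rewrite -(@ler_pXn2r _ 2) ?nnegrE ?exprn_ge0 //; last first.
  by rewrite !mulr_ge0 // ltW ?c_gt0.
rewrite -exprM mulnC exprM -natrX (le_trans (exp16_le_catalan m)) //.
rewrite -[m.+1%:R]natr1 in mr *.
rewrite -mulrA [leRHS]exprMn; apply: ler_wpM2r; first exact: sqr_ge0.
by rewrite exprMn; lra.
Qed.

(** Growing [c b] by [a.+1] indices costs at most 4^(a+1), and 4^a is paid for by [c a]. *)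
Lemma catalan_merge_le a b (r : R) : 0 <= r -> a.+1%:R <= r ^+ 2 ->
  c (a + b).+1 <= 8 * r * a.+1%:R * (c a * c b).
Proof.
move=> r0 ar; rewrite -addSn addnC (le_trans (catalanD_le _ _)) // mulrA.
rewrite ler_pM2r ?c_gt0 // exprS.
have := exp4_le_catalan r0 ar; lra.
Qed.

End CatalanRecurrence.

Section Catalan.
Variable R : realType.
Implicit Type k : nat.

Lemma Cat_gt0 k : 0 < Cat R k.
Proof. by rewrite /Cat divr_gt0 ?mulr_gt0 ?ltr0n ?fact_gt0. Qed.

Lemma Cat0 : Cat R 0 = 1.
Proof. by rewrite /Cat muln0 fact0 factS fact0 mulr1 divr1. Qed.

Lemma Cat_rec k : (k%:R + 2) * Cat R k.+1 = 2 * (2 * k%:R + 1) * Cat R k.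
Proof.
have h1 : (k`!)%:R != 0 :> R by rewrite pnatr_eq0 -lt0n fact_gt0.
rewrite /Cat mulnS addSn add1n !factS !natrM -!natr1 !natrM.
have k0 : 0 <= k%:R :> R by [].
field; rewrite h1 /=; apply/andP; split; apply/eqP; lra.
Qed.


Lemma sum_Cat m : \sum_(i < m.+1) Cat R i * Cat R (m - i) = Cat R m.+1.
Proof. exact: catalan_convolution Cat0 Cat_rec m. Qed.

(* The cost of merging cycles of lengths [a.+1] and [b.+1]. *)
Lemma Cat_merge_le a b (r : R) : 0 <= r -> a.+1%:R <= r ^+ 2 ->
  Cat R (a + b).+1 <= 8 * r * a.+1%:R * (Cat R a * Cat R b).
Proof. exact: catalan_merge_le Cat_gt0 Cat0 Cat_rec a b r. Qed.

End Catalan.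

(** * The Moebius weight under cuts and merges *)

Section CycleWeight.
Variable R : realType.

(** The absolute value of [Moeb], stated over any finite type; see [normr_Moeb]. *)
Definition cycle_weight (T : finType) (s : {perm T}) : R :=
  \prod_(C in porbits s) Cat R (#|C| - 1).

Lemma cycle_weight_gt0 (T : finType) (s : {perm T}) : 0 < cycle_weight s.
Proof. by apply: prodr_gt0 => C _; exact: Cat_gt0. Qed.

Lemma cycle_weight_cut (T : finType) (s : {perm T}) (y : T) (k : nat)
    (t := (s * tperm (iter k s y) y)%g) :
  (0 < k)%N -> (k < #|porbit s y|)%N ->
  #|porbits t| = #|porbits s|.+1 /\
  cycle_weight t * Cat R (#|porbit s y| - 1) =
  cycle_weight s * (Cat R (k - 1) * Cat R (#|porbit s y| - k - 1)).
Proof.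
move=> k0 ka; have [ny nx E yN xN] := porbits_cut k0 ka.
have sy : porbit s y \in porbits s by apply/imsetP; exists y.
rewrite /cycle_weight /t E; split.
  by rewrite !cardsU1 xN yN [in RHS](cardsD1 (porbit s y)) sy.
rewrite big_setU1 // big_setU1 //= ny nx [in RHS](big_setD1 _ sy) /=.
move: (Cat R (k - 1)) (Cat R (_ - k - 1)) (Cat R _) (\prod_(_ in _) _) => a b c d.
by ring.
Qed.

(** Otherwise each of two multiplications by the same transposition would lower the number of cycles
    by one, although together they cancel. Inverses appear because [porbits_mul_tperm] multiplies on
    the left. *)
Lemma mem_porbit_tperm (T : finType) (s : {perm T}) (x y : T) :
  x != y -> x \notin porbit s y -> x \in porbit (s * tperm x y)%g y.
Proof.
move=> xy xN; apply/negPn/negP => xN'.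
have tV : (s * tperm x y)^-1%g = (tperm x y * s^-1)%g by rewrite invMg tpermV.
have := porbits_mul_tperm s^-1 x y; have := porbits_mul_tperm (s * tperm x y)^-1 x y.
by rewrite /= !porbitV xN xN' xy tV mulgA tperm2 mul1g /=; lia.
Qed.

(* A merge is undone by the same transposition, so it is a cut read backwards. *)
Lemma cycle_weight_merge (T : finType) (s : {perm T}) (x y : T) (r : R)
    (t := (s * tperm x y)%g) :
  x \notin porbit s y -> 0 <= r -> #|porbit s y|%:R <= r ^+ 2 ->
  #|porbits s| = #|porbits t|.+1 /\
  cycle_weight t <= 8 * r * #|porbit s y|%:R * cycle_weight s.
Proof.
move=> xN r0 kr.
have xy : x != y by apply: contraNneq xN => ->; exact: porbit_id.
have := mem_porbit_tperm xy xN; rewrite -/t porbit_traject => /trajectP[k ka xk].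
have k0 : (0 < k)%N by case: k xk {ka} => // e; rewrite e eqxx in xy.
have st : s = (t * tperm (iter k t y) y)%g by rewrite -xk -mulgA tperm2 mulg1.
have [ny _ _ _ _] := porbits_cut k0 ka.
have := cycle_weight_cut k0 ka; rewrite -st => -[-> e]; split=> //.
(* The piece of length [k] is the cycle of [y] under [s], so [kr] now bounds [k]. *)
rewrite -st in ny; rewrite ny in kr *.
have kE : k = (k - 1).+1 by lia.
have aE : (#|porbit t y| - 1 = (k - 1 + (#|porbit t y| - k - 1)).+1)%N by lia.
have := @Cat_merge_le R (k - 1) (#|porbit t y| - k - 1) r r0.
rewrite -aE -kE => /(_ kr) le.
have w0 := cycle_weight_gt0 s.
have c0 : 0 < Cat R (k - 1) * Cat R (#|porbit t y| - k - 1) by rewrite mulr_gt0 ?Cat_gt0.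
rewrite -(ler_pM2r c0) -e mulrAC [leLHS]mulrC.
by rewrite ler_pM2r.
Qed.

Lemma sum_porbit_iter (T : finType) (s : {perm T}) (y : T) (f : T -> R) :
  \sum_(x in porbit s y) f x = \sum_(k < #|porbit s y|) f (iter k s y).
Proof.
rewrite (eq_bigl _ _ (porbit_traject s y)) -big_uniq ?uniq_traject_porbit //=.
rewrite (big_nth y) size_traject big_mkord; apply: eq_bigr => k _.
by rewrite nth_traject.
Qed.

(** Cutting at distance k leaves cycles of lengths k and a - k, so this is Segner's recurrence for
    the cycle length a. As [y] is moved, a is at least 2. *)
Lemma sum_cycle_weight_cut (T : finType) (s : {perm T}) (y : T) : s y != y ->
  \sum_(x in porbit s y | x != y) cycle_weight (s * tperm x y)%g = cycle_weight s.
Proof.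
move=> sy; pose f x := if x != y then cycle_weight (s * tperm x y)%g else 0.
have -> : \sum_(x in porbit s y | x != y) cycle_weight (s * tperm x y)%g =
          \sum_(x in porbit s y) f x by rewrite big_mkcondr.
rewrite sum_porbit_iter.
have a1 : (1 < #|porbit s y|)%N.
  rewrite ltn_neqAle lt0n card_porbit_neq0 andbT; apply: contra sy => /eqP e.
  by have := iter_porbit s y; rewrite -e /= => ->.
case E : #|porbit s y| a1 => [//|[//|m]] _.
(* The term at distance 0 is the excluded [x = y], where [f] vanishes. *)
rewrite big_ord_recl /= {1}/f eqxx add0r.
have c0 : Cat R m.+1 != 0 by rewrite gt_eqF ?Cat_gt0.
apply: (mulIf c0); rewrite -[in RHS]sum_Cat mulr_suml mulr_sumr.
apply: eq_bigr => i _; rewrite -[s (iter _ _ _)]/(iter i.+1 s y).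
have im : (i < m.+1)%N by [].
have [|_] := @cycle_weight_cut T s y i.+1 (ltn0Sn _); first by rewrite E; lia.
rewrite E; have -> : (m.+2 - 1 = m.+1)%N by lia.
have -> : (i.+1 - 1 = i)%N by lia.
have -> : (m.+2 - i.+1 - 1 = m - i)%N by lia.
move=> <-; rewrite /f ifT //; apply/eqP => /(@iter_porbit_inj _ s y i.+1 0).
by rewrite E; lia.
Qed.

End CycleWeight.

Section Weight.
Variables (R : realType) (w : R).
Hypothesis w_ge0 : 0 <= w.

Definition perm_weight (n : nat) (s : 'S_n) : R :=
  w ^+ perm_length s * cycle_weight R s.

Lemma perm_weight_ge0 (n : nat) (s : 'S_n) : 0 <= perm_weight s.
Proof. by rewrite mulr_ge0 ?exprn_ge0 // ltW // cycle_weight_gt0. Qed.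

Lemma card_porbits_le (n : nat) (s : 'S_n) : (#|porbits s| <= n)%N.
Proof. by rewrite (leq_trans (leq_imset_card _ _)) ?card_ord. Qed.

(** A cut creates one cycle and so lowers [perm_length] by one; the factor [w] restores the
    power. *)
Lemma sum_perm_weight_cut (n : nat) (s : 'S_n) (y : 'I_n) : s y != y ->
  w * \sum_(x in porbit s y | x != y) perm_weight (s * tperm x y)%g =
  perm_weight s.
Proof.
move=> sy; rewrite /perm_weight -[in RHS](sum_cycle_weight_cut R sy) !mulr_sumr.
apply: eq_bigr => x /andP[xC xy]; rewrite mulrA -exprS; congr (w ^+ _ * _).
move: xC; rewrite porbit_traject => /trajectP[k ka xk].
have k0 : (0 < k)%N by case: k xk {ka} => // e; rewrite e eqxx in xy.
have [e _] := cycle_weight_cut R k0 ka; rewrite /perm_length xk e.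
(* [perm_length] is a truncated subtraction, hence the bound on the number of cycles. *)
by have := card_porbits_le (s * tperm (iter k s y) y)%g; rewrite e; lia.
Qed.

Lemma perm_weight_merge (n : nat) (s : 'S_n) (x y : 'I_n) (r : R) :
  x \notin porbit s y -> 0 <= r -> #|porbit s y|%:R <= r ^+ 2 ->
  perm_weight (s * tperm x y)%g <=
  8 * r * #|porbit s y|%:R * (w * perm_weight s).
Proof.
move=> xN r0 kr; have [e le] := cycle_weight_merge xN r0 kr.
rewrite /perm_weight.
have -> : perm_length (s * tperm x y) = (perm_length s).+1.
  by rewrite /perm_length e subnSK // -e card_porbits_le.
have wl : 0 <= w ^+ (perm_length s).+1 by rewrite exprn_ge0.
rewrite (le_trans (ler_wpM2l wl le)) // exprS.
move: (w ^+ _) (cycle_weight _ _) (_%:R) => a b c.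
by rewrite le_eqVlt; apply/orP; left; apply/eqP; ring.
Qed.

End Weight.

(** * The supersolution *)

Section Restriction.
Variables (m : nat) (s : 'S_m.+1) (t : 'S_m).
Hypothesis st : forall i : 'I_m, s (lift ord_max i) = lift ord_max (t i).

(** Every letter below the last is already the image under [s] of such a letter, because [t] is
    onto. *)
Lemma restr_fix : s ord_max = ord_max.
Proof.
case: (unliftP ord_max (s ord_max)) => // j e; exfalso.
have := st (t^-1 j)%g; rewrite permKV -e => /perm_inj /eqP.
by rewrite eq_sym (negPf (neq_lift _ _)).
Qed.

Lemma porbit_restr (i : 'I_m) :
  porbit s (lift ord_max i) = lift ord_max @: porbit t i.
Proof.
have e k : (s ^+ k)%g (lift ord_max i) = lift ord_max ((t ^+ k)%g i).
  elim: k => [|k IH]; first by rewrite !expg0 !perm1.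
  by rewrite !expgSr !permM IH st.
apply/setP => u; apply/porbitP/imsetP => [[k ->]|[v /porbitP[k ->] ->]].
  by exists ((t ^+ k)%g i); rewrite ?mem_porbit.
by exists k.
Qed.

Lemma porbit_restr_max : porbit s ord_max = [set ord_max].
Proof.
apply/setP => u; rewrite (@porbit_traject_iter _ s ord_max 1) ?inE //.
exact: restr_fix.
Qed.

Lemma porbits_restr :
  porbits s = [set ord_max] |: ((fun C : {set 'I_m} => lift ord_max @: C) @: porbits t).
Proof.
apply/setP => C; apply/imsetP/setU1P => [[u _ ->]|[->|/imsetP[B /imsetP[i _ ->] ->]]].
- case: (unliftP ord_max u) => [i ->|->]; last by left; rewrite porbit_restr_max.
  by right; rewrite porbit_restr imset_f // imset_f.
- by exists ord_max; rewrite ?porbit_restr_max.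
- by exists (lift ord_max i); rewrite ?porbit_restr.
Qed.

Lemma imset_lift_inj : injective (fun C : {set 'I_m} => lift ord_max @: C).
Proof. exact: imset_inj (@lift_inj _ _). Qed.

Lemma max_notin_restr :
  [set ord_max] \notin (fun C : {set 'I_m} => lift ord_max @: C) @: porbits t.
Proof.
apply/imsetP => -[C _ /setP /(_ ord_max)]; rewrite inE eqxx => /esym /imsetP[i _].
by move/eqP; rewrite (negPf (neq_lift _ _)).
Qed.

(** Restriction removes one letter and one cycle, and these cancel in the difference. *)
Lemma perm_length_restr : perm_length s = perm_length t.
Proof.
by rewrite /perm_length porbits_restr cardsU1 max_notin_restr card_imset ?subSS //;
  exact: imset_lift_inj.
Qed.

Lemma cycle_weight_restr (R : realType) : cycle_weight R s = cycle_weight R t.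
Proof.
rewrite /cycle_weight porbits_restr big_setU1 ?max_notin_restr //=.
rewrite cards1 subnn Cat0 mul1r big_imset /=; last by move=> ? ? _ _ /imset_lift_inj.
by apply: eq_bigr => C _; rewrite card_imset //; exact: lift_inj.
Qed.

End Restriction.

Section Supersolution.
Variables (R : realType) (n : nat) (x q r D : R).
Hypotheses (x_ge0 : 0 <= x) (q_gt0 : 0 < q) (r_ge0 : 0 <= r) (D_ge1 : 1 <= D).
Hypothesis nr : n%:R <= r ^+ 2.
Hypothesis qP : 1 + 8 * n%:R ^+ 2 * r * x ^+ 2 * q ^+ 2 <= q.
Hypothesis DP : 1 + 8 * n%:R * x ^+ 2 * q * D <= D.

Let w := x * q.
Let w_ge0 : 0 <= w. Proof. by rewrite mulr_ge0 // ltW. Qed.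

Lemma sum_perm_weight_merge (k : nat) (s : 'S_k) (y : 'I_k) (e : R) :
  0 <= e -> #|porbit s y|%:R <= e ^+ 2 ->
  \sum_(z | (z != y) && (z \notin porbit s y)) perm_weight w (s * tperm z y)%g <=
  k%:R * (8 * e * #|porbit s y|%:R * (w * perm_weight w s)).
Proof.
move=> e0 ke; set B := 8 * e * _ * _.
have P0 := perm_weight_ge0 w_ge0 s.
have B0 : 0 <= B.
  by apply: mulr_ge0 (mulr_ge0 w_ge0 P0); rewrite !mulr_ge0.
apply: (@le_trans _ _ (\sum_(z | (z != y) && (z \notin porbit s y)) B)).
  by apply: ler_sum => z /andP[_ zN]; exact: perm_weight_merge.
rewrite sumr_const -[leLHS]mulr_natl ler_wpM2r // ler_nat.
by rewrite -[leqRHS]card_ord max_card.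
Qed.

Lemma sum_lift_max (k : nat) (f : 'I_k.+1 -> R) :
  \sum_(j < k) f (lift ord_max j) = \sum_(z | z != ord_max) f z.
Proof.
rewrite [RHS]big_mkcond (bigD1_ord ord_max) //= eqxx add0r.
by apply: eq_bigr => j _; rewrite eq_sym neq_lift.
Qed.

(** The dominating function F. *)
Definition level_weight (k : nat) (s : 'S_k) : R := perm_weight w s * D ^+ k.

Lemma level_weight_ge0 (k : nat) (s : 'S_k) : 0 <= level_weight s.
Proof.
by rewrite mulr_ge0 ?perm_weight_ge0 // exprn_ge0 // (le_trans ler01).
Qed.

Lemma level_weight_cut (k : nat) (s : 'S_k.+1) : (k < n)%N ->
  s ord_max != ord_max ->
  x * \sum_(j < k) level_weight (s * tperm (lift ord_max j) ord_max)%g <=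
  level_weight s.
Proof.
move=> kn smax.
rewrite (@sum_lift_max k (fun z => level_weight (s * tperm z ord_max)%g)).
rewrite -mulr_suml mulrA ler_wpM2r ?exprn_ge0 ?(le_trans ler01) //.
(* Separate cuts from merges. Multiplying by [q] turns [x] into [w], so the cuts sum to exactly [P],
   and [qP] absorbs the merges. *)
rewrite (bigID (fun z => z \in porbit s ord_max)) /= -(ler_pM2l q_gt0).
rewrite mulrA [q * x]mulrC -/w mulrDr.
under eq_bigl => z do rewrite andbC.
rewrite sum_perm_weight_cut //; set P := perm_weight w s.
have P0 : 0 <= P by exact: perm_weight_ge0.
have wP0 : 0 <= w * P := mulr_ge0 w_ge0 P0.
have kn' : k.+1%:R <= n%:R :> R by rewrite ler_nat.
have an : #|porbit s ord_max|%:R <= n%:R :> R.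
  by rewrite ler_nat (leq_trans (max_card _)) // card_ord.
have := sum_perm_weight_merge r_ge0 (le_trans an nr); rewrite -/P.
set S := \sum_(_ | _) _ => SP.
have n0 : 0 <= n%:R :> R by [].
have SP' : S <= n%:R * (8 * r * n%:R * (w * P)).
  apply: (le_trans SP); apply: ler_pM => //.
    by apply: mulr_ge0 wP0; rewrite !mulr_ge0.
  by rewrite ler_wpM2r // ler_wpM2l // mulr_ge0.
apply: (@le_trans _ _ (P + w * (n%:R * (8 * r * n%:R * (w * P))))).
  by rewrite lerD2l ler_wpM2l.
have -> : P + w * (n%:R * (8 * r * n%:R * (w * P))) =
  (1 + 8 * n%:R ^+ 2 * r * x ^+ 2 * q ^+ 2) * P by rewrite /w; ring.
by rewrite ler_wpM2r.
Qed.

(** There are only merges here. [s] and [t] have the same [perm_weight], but [s] carries one more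
    factor [D], whose excess over 1 pays for the merges by [DP]. *)
Lemma level_weight_restr (k : nat) (s : 'S_k.+1) (t : 'S_k) : (k < n)%N ->
  (forall i : 'I_k, s (lift ord_max i) = lift ord_max (t i)) ->
  x * \sum_(j < k) level_weight (s * tperm (lift ord_max j) ord_max)%g +
    level_weight t <= level_weight s.
Proof.
move=> kn st.
rewrite (@sum_lift_max k (fun z => level_weight (s * tperm z ord_max)%g)).
have a1 := porbit_restr_max st.
have tE : perm_weight w t = perm_weight w s.
  by rewrite /perm_weight (perm_length_restr st) (cycle_weight_restr st).
rewrite -mulr_suml /level_weight tE; set P := perm_weight w s.
have P0 : 0 <= P by exact: perm_weight_ge0.
have wP0 : 0 <= w * P := mulr_ge0 w_ge0 P0.
(* The cycle of the last letter has length 1, so 1 replaces [r]. *)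
have := @sum_perm_weight_merge _ s ord_max 1 ler01.
rewrite a1 cards1 expr1n lexx => /(_ isT); rewrite -/P.
under eq_bigl => z do rewrite inE andbb.
set S := \sum_(_ | _) _ => SP.
have kn' : k.+1%:R <= n%:R :> R by rewrite ler_nat.
have SP' : S <= n%:R * (8 * 1 * 1 * (w * P)).
  by apply: (le_trans SP); rewrite ler_wpM2r //; apply: mulr_ge0 wP0; rewrite !mulr_ge0.
have D0 : 0 <= D ^+ k by rewrite exprn_ge0 // (le_trans ler01).
have -> : x * (S * D ^+ k.+1) + P * D ^+ k = (x * S * D + P) * D ^+ k.
  by rewrite exprS; ring.
have -> : P * D ^+ k.+1 = D * P * D ^+ k by rewrite exprS; ring.
rewrite ler_wpM2r //.
apply: (@le_trans _ _ (x * (n%:R * (8 * 1 * 1 * (w * P))) * D + P)).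
  by rewrite lerD2r ler_wpM2r ?(le_trans ler01) // ler_wpM2l.
have -> : x * (n%:R * (8 * 1 * 1 * (w * P))) * D + P =
  (1 + 8 * n%:R * x ^+ 2 * q * D) * P by rewrite /w; ring.
by rewrite ler_wpM2r.
Qed.

End Supersolution.

(** * Sums over paths *)

Definition solid_succ (k : nat) (s : 'S_k.+1) : seq vertex :=
  [seq vtx (s * tperm (lift ord_max j) ord_max)%g | j <- enum 'I_k].

Definition dashed_succ (k : nat) (s : 'S_k.+1) : seq vertex :=
  if [pick t : 'S_k | [forall i, s (lift ord_max i) == lift ord_max (t i)]]
    is Some t then [:: vtx t] else [::].

Definition succ_list (u : vertex) : seq vertex :=
  let: existT n s := u in
  match n return 'S_n -> seq vertex with
  | 0 => fun=> [::]
  | k.+1 => fun s : 'S_k.+1 => solid_succ s ++ dashed_succ s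
  end s.

Lemma succ_list_edge (u v : vertex) : edge u v -> v \in succ_list u.
Proof.
case: u => -[|k] s //= /orP[/existsP[j /eqP ->]|].
  by rewrite mem_cat; apply/orP; left; apply: map_f; rewrite mem_enum.
move=> /andP[_ /existsP[t /andP[/eqP -> /forallP st]]].
rewrite mem_cat /dashed_succ; case: pickP => [t' /forallP st'|/(_ t)]; last first.
  by move=> /negP; case; apply/forallP.
suff -> : t = t' by rewrite mem_head orbT.
by apply/permP => i; apply: (@lift_inj _ ord_max); rewrite -(eqP (st i)) (eqP (st' i)).
Qed.

Lemma succ_list_tag (u v : vertex) : v \in succ_list u -> (tag v <= tag u)%N.
Proof.
case: u => -[|k] s //=; rewrite mem_cat => /orP[/mapP[j _ ->] //|].
by rewrite /dashed_succ; case: pickP => // t _; rewrite inE => /eqP ->.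
Qed.

Lemma perm_fix_max_restr (k : nat) (s : 'S_k.+1) : s ord_max = ord_max ->
  exists t : 'S_k, forall i, s (lift ord_max i) = lift ord_max (t i).
Proof.
move=> smax; pose f i := odflt i (unlift ord_max (s (lift ord_max i))).
have fE i : s (lift ord_max i) = lift ord_max (f i).
  rewrite /f; case: unliftP => // e; move: e; rewrite -{2}smax => /perm_inj /eqP.
  by rewrite eq_sym (negPf (neq_lift _ _)).
have f_inj : injective f.
  move=> i j ij; apply: (@lift_inj _ ord_max); apply: (@perm_inj _ s).
  by rewrite !fE ij.
by exists (perm f_inj) => i; rewrite permE fE.
Qed.

(** An explicit list of the paths to the empty vertex with at most [k] edges, so that sums over it
    split along the first edge. *)
Fixpoint walks (k : nat) (u : vertex) : seq (seq vertex) :=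
  (if u == empty_vertex then [:: [::]] else [::]) ++
  (if k is k'.+1 then [seq v :: p | v <- succ_list u, p <- walks k' v] else [::]).

Lemma mem_walks (k : nat) (u : vertex) (p : seq vertex) :
  path edge u p -> last u p = empty_vertex -> (size p <= k)%N -> p \in walks k u.
Proof.
elim: k u p => [|k IH] u [|v p] //=; first by move=> _ ->; rewrite eqxx.
  by move=> _ ->; rewrite eqxx.
move=> /andP[uv vp] lp pk; rewrite mem_cat; apply/orP; right.
apply/allpairsPdep; exists v, p; split=> //; first exact: succ_list_edge.
exact: IH.
Qed.

Lemma solid_countE (u v : vertex) (p : seq vertex) :
  solid_count u (v :: p) = (solid_edge u v + solid_count v p)%N.
Proof. by []. Qed.

Section WalkSum.
Variables (R : realType) (n : nat) (x q r D : R).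
Hypotheses (x_ge0 : 0 <= x) (q_gt0 : 0 < q) (r_ge0 : 0 <= r) (D_ge1 : 1 <= D).
Hypothesis nr : n%:R <= r ^+ 2.
Hypothesis qP : 1 + 8 * n%:R ^+ 2 * r * x ^+ 2 * q ^+ 2 <= q.
Hypothesis DP : 1 + 8 * n%:R * x ^+ 2 * q * D <= D.

Let weight (u : vertex) : R := let: existT k s := u in level_weight x q D s.

Let weight_ge0 u : 0 <= weight u.
Proof. by case: u => k s; exact: level_weight_ge0. Qed.

Lemma level_weight_empty (s : 'S_0) : level_weight x q D s = 1.
Proof.
have s0 : porbits s = finset.set0.
  by apply/setP => C; rewrite inE; apply/imsetP => -[[]].
by rewrite /level_weight /perm_weight /cycle_weight /perm_length s0 finset.big_set0 !mulr1.
Qed.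

(** The supersolution inequality at one vertex. The boolean exponent gives weight [x] to solid edges
    and 1 to dashed ones. *)
Lemma succ_weight (u : vertex) : u != empty_vertex -> (tag u <= n)%N ->
  \sum_(v <- succ_list u) x ^+ solid_edge u v * weight v <= weight u.
Proof.
case: u => -[|k] s; first by move=> _ _; rewrite big_nil weight_ge0.
move=> _ /= kn; rewrite big_cat big_map big_enum /=.
under eq_bigr => j _.
  rewrite (_ : [exists i, _] = true); last by apply/existsP; exists j.
  over.
rewrite -mulr_sumr expr1 /dashed_succ.
case: pickP => [t /forallP st|none].
  rewrite big_seq1 (_ : [exists i, _] = false); last first.
    by apply/existsP => -[i /eqP /(congr1 tag) /= /eqP]; rewrite eqn_leq ltnn andbF.
  rewrite expr0 mul1r; apply: (level_weight_restr x_ge0 q_gt0 D_ge1 DP kn) => i.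
  exact/eqP.
rewrite big_nil addr0; apply: (level_weight_cut x_ge0 q_gt0 r_ge0 D_ge1 nr qP kn).
apply/eqP => /perm_fix_max_restr[t st].
by have /negP[] := none t; apply/forallP => i; rewrite st.
Qed.

(** Induction on the number of edges, with [succ_weight] applied to the first edge. The empty vertex
    has no successor, so its only walk is the trivial one, of weight 1. *)
Lemma sum_walks_le (k : nat) (u : vertex) : (tag u <= n)%N ->
  \sum_(p <- walks k u) x ^+ solid_count u p <= weight u.
Proof.
elim: k u => [|k IH] u un /=; rewrite big_cat /=; case: eqP => [->|/eqP ue].
- by rewrite big_seq1 big_nil addr0 /= level_weight_empty.
- by rewrite !big_nil addr0 weight_ge0.
- by rewrite big_seq1 big_nil addr0 /= level_weight_empty.
rewrite big_nil add0r big_allpairs_dep /=.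
apply: le_trans (succ_weight ue un); rewrite big_seq [leRHS]big_seq.
apply: ler_sum => v vu.
under eq_bigr => p _ do rewrite solid_countE exprD.
rewrite -mulr_sumr ler_wpM2l ?exprn_ge0 // IH //.
exact: leq_trans (succ_list_tag vu) un.
Qed.

(** Each of the [k] levels is left by one dashed edge, so a path with [l] solid edges has [k + l]
    edges and is listed in [walks L]. *)
Lemma num_wpaths_le (k : nat) (s : 'S_k) (l L : nat) : (k + l <= L)%N ->
  (num_wpaths s l <= count (fun p => solid_count (vtx s) p == l) (walks L (vtx s)))%N.
Proof.
move=> klL; rewrite -size_filter; apply: uniq_leq_size; first exact: fset_uniq.
move=> p; rewrite in_fset_set; last exact: finite_wpaths.
rewrite inE => -[sp lp cp]; rewrite mem_filter cp eqxx mem_walks //.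
by have := size_path_edge sp; rewrite lp cp addn0 => ->.
Qed.

Lemma sum_num_wpaths_le (k : nat) (s : 'S_k) (l G : nat) : (k <= n)%N ->
  \sum_(g < G) (num_wpaths s (l + 2 * g))%:R * x ^+ (l + 2 * g) <=
  level_weight x q D s.
Proof.
move=> kn; pose L := (k + (l + 2 * G))%N.
apply: le_trans (sum_walks_le L (u := vtx s) kn).
pose c p := solid_count (vtx s) p.
apply: (@le_trans _ _ (\sum_(g < G) \sum_(p <- walks L (vtx s))
    if c p == (l + 2 * g)%N then x ^+ c p else 0)).
  apply: ler_sum => g _.
  have kL : (k + (l + 2 * g) <= L)%N by rewrite /L; have := ltn_ord g; lia.
  have := num_wpaths_le s kL; rewrite -(ler_nat R) => le.
  rewrite (le_trans (ler_wpM2r (exprn_ge0 _ x_ge0) le)) // -sum1_count natr_sum.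
  rewrite mulr_suml big_mkcond le_eqVlt; apply/orP; left; apply/eqP.
  apply: eq_bigr => p _; rewrite -/(c p); case: eqP => // ->.
  by rewrite mul1r.
(* A walk has a single solid count, so it contributes to at most one [g]. *)
rewrite exchange_big /=; apply: ler_sum => p _; rewrite -/(c p).
case: (pickP (fun g : 'I_G => c p == (l + 2 * g)%N)) => [g /eqP cg|no].
  rewrite (bigD1 g) //= cg eqxx big1 ?addr0 // => h hg.
  by rewrite ifF //; apply: contra_neqF hg => /eqP e; apply: val_inj => /=; lia.
by rewrite big1 ?exprn_ge0 // => h _; rewrite no.
Qed.

End WalkSum.

(** * The bound *)

Lemma normr_Moeb (R : realType) (n : nat) (s : 'S_n) :
  `|Moeb R s| = cycle_weight R s.
Proof.
by rewrite normrM normrX normrN1 expr1n mul1r ger0_norm // ltW // cycle_weight_gt0.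
Qed.

(** The terms are nonnegative, so the bound on the partial sums yields convergence as well, and the
    limit inherits the bound. *)
Lemma normr_WgU_le (R : realType) (N n : nat) (s : 'S_n) (B : R) : (0 < N)%N ->
  (forall G, \sum_(g < G) (num_wpaths s (perm_length s + 2 * g))%:R *
     N%:R ^- (2 * g) <= B) ->
  N%:R ^+ (n + perm_length s) * `|WgU R N s| <= B.
Proof.
move=> N0 uB; rewrite /WgU; set u := fun g : nat => _.
have u0 g : 0 <= u g by rewrite mulr_ge0 ?invr_ge0 ?exprn_ge0.
have sB G : series u G <= B by rewrite /series /= big_mkord; exact: uB.
have cu : cvgn (series u).
  apply: nondecreasing_is_cvgn.
    by apply/nondecreasing_seqP => k; rewrite /series /= big_nat_recr //= lerDl.
  by exists B => _ [k _ <-].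
have l0 : 0 <= limn (series u).
  by apply: limr_ge => //; near=> k; apply: sumr_ge0.
have lB : limn (series u) <= B by apply: limr_le => //; near=> k; exact: sB.
have Np : 0 < N%:R ^+ (n + perm_length s) :> R by rewrite exprn_gt0 // ltr0n.
rewrite !normrM normrX normrN1 expr1n mul1r (ger0_norm l0).
rewrite ger0_norm ?invr_ge0 ?(ltW Np) //.
by rewrite mulrA mulfV ?mul1r // gt_eqF.
Unshelve. all: by end_near.
Qed.

Lemma powR_5half (R : realType) (n : nat) :
  n%:R `^ (5%:R / 2%:R) = n%:R ^+ 2 * Num.sqrt n%:R :> R.
Proof.
rewrite (_ : 5%:R / 2%:R = 2%:R + 2^-1 :> R); last by field.
rewrite powRD ?powR_mulrn ?powR12_sqrt //.
by apply/implyP => /eqP; lra.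
Qed.

Lemma powR_5half_le (R : realType) (n N : nat) :
  n%:R <= 10%:R ^- 4 * N%:R `^ (4%:R / 5%:R) :> R ->
  n%:R `^ (5%:R / 2%:R) <= 10%:R ^- 4 * N%:R ^+ 2 :> R.
Proof.
move=> h; have c0 : 0 <= 10%:R ^- 4 :> R by rewrite invr_ge0 exprn_ge0.
have p0 : 0 <= 5%:R / 2%:R :> R by [].
apply: (le_trans (ge0_ler_powR p0 _ _ h)).
- by rewrite nnegrE.
- by rewrite nnegrE mulr_ge0 ?powR_ge0.
rewrite powRM ?powR_ge0 // -powRrM.
rewrite (_ : 4%:R / 5%:R * (5%:R / 2%:R) = 2%:R :> R); last by field.
rewrite powR_mulrn // ler_wpM2r ?exprn_ge0 //.
(* The constant is now (10^-4)^(5/2), relaxed to 10^-4 because the base is at most 1. *)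
rewrite -[leRHS]powRr1 // ger_powR //; last by lra.
by rewrite invr_gt0 exprn_gt0 //= invf_le1 ?exprn_gt0 // exprn_ege1 // ler1n.
Qed.

(** With q = 1 + 25 L and D = 1 + 10 E so close to 1, both 8 q^2 <= 25 and 8 q D <= 10 hold. *)
Lemma supersolution_parameters (R : realFieldType) (L E : R) :
  0 <= E -> E <= L -> L <= 1 / 10000 ->
  [/\ 0 < 1 + 25 * L, 1 <= 1 + 10 * E,
      1 + 8 * L * (1 + 25 * L) ^+ 2 <= 1 + 25 * L &
      1 + 8 * E * ((1 + 25 * L) * (1 + 10 * E)) <= 1 + 10 * E].
Proof. by move=> E0 EL L1; split; nra. Qed.

Theorem theorem1p6 (R : realType) (n N : nat) (hn : (1 <= n)%N)
    (hN : (1 <= N)%N)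
    (hnN : n%:R <= 10%:R ^- 4 * N%:R `^ (4%:R / 5%:R) :> R)
    (s : 'S_n) (hs : (4 <= perm_length s)%N) :
  ln (N%:R ^+ (n + perm_length s) * `|WgU R N s| / `|Moeb R s|)
    <= 25%:R * (n%:R `^ (5%:R / 2%:R) / N%:R ^+ 2) * (perm_length s)%:R
       + ln (perm_length s)%:R + 2%:R.
Proof.
set l := perm_length s.
have N0 : 0 < N%:R :> R by rewrite ltr0n.
have n1 : 1 <= n%:R :> R by rewrite ler1n.
set x : R := N%:R^-1; set r : R := Num.sqrt n%:R.
have x0 : 0 < x by rewrite invr_gt0.
have rr : r ^+ 2 = n%:R by rewrite sqr_sqrtr.
have r0 : 0 <= r by exact: sqrtr_ge0.
have r1 : 1 <= r by rewrite -(@ler_pXn2r _ 2) ?nnegrE // rr expr1n.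
set L : R := n%:R `^ (5%:R / 2%:R) / N%:R ^+ 2.
have LE : L = n%:R ^+ 2 * r * x ^+ 2 by rewrite /L powR_5half exprVn.
have Lsmall : L <= 10%:R ^- 4.
  by rewrite ler_pdivrMr ?exprn_gt0 //; exact: powR_5half_le.
have {}Lsmall : L <= 1 / 10000.
  by apply: (le_trans Lsmall); rewrite le_eqVlt; apply/orP; left; apply/eqP; field.
set E : R := n%:R * x ^+ 2.
have x2 : 0 < x ^+ 2 by rewrite exprn_gt0.
have E0 : 0 <= E by rewrite mulr_ge0 // ltW.
(* n E = n^2 / N^2 lacks only the factor [r >= 1] of [L]; this keeps D^n below exp 1. *)
have nE : n%:R * E <= L.
  rewrite LE mulrA -expr2 ler_wpM2r ?(ltW x2) // //.
  by rewrite -[leLHS]mulr1 ler_wpM2l ?exprn_ge0.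
have EL : E <= L by apply: le_trans nE; rewrite ler_peMl.
have L0 : 0 <= L := le_trans E0 EL.
set q := 1 + 25 * L; set D := 1 + 10 * E.
have [q0 D1 qP DP] := supersolution_parameters E0 EL Lsmall.
rewrite -/q -/D in q0 D1 qP DP.
have {}qP : 1 + 8 * n%:R ^+ 2 * r * x ^+ 2 * q ^+ 2 <= q.
  by move: qP; rewrite LE !mulrA.
have {}DP : 1 + 8 * n%:R * x ^+ 2 * q * D <= D.
  by move: DP; rewrite /E !mulrA.
have nr : n%:R <= r ^+ 2 by rewrite rr.
have WB : N%:R ^+ (n + l) * `|WgU R N s| <= q ^+ l * cycle_weight R s * D ^+ n.
  apply: normr_WgU_le => // G.
  (* The factor x^l turns N^(-2g) into the path weight x^(l+2g). *)
  rewrite -(@ler_pM2l _ (x ^+ l)) ?exprn_gt0 // mulr_sumr.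
  have := sum_num_wpaths_le (ltW x0) q0 r0 D1 nr qP DP s l G (leqnn n).
  rewrite /level_weight /perm_weight -/l exprMn !mulrA; apply: le_trans.
  rewrite le_eqVlt; apply/orP; left; apply/eqP; apply: eq_bigr => g _.
  by rewrite mulrCA -exprVn -exprD.
set Q := _ / _.
have Qle : Q <= expR (25%:R * L * l%:R + 1).
  rewrite /Q ler_pdivrMr normr_Moeb ?cycle_weight_gt0 //.
  apply: (le_trans WB); rewrite -mulrA mulrCA mulrC ler_pM2r ?cycle_weight_gt0 //.
  (* Both q^l and D^n are bounded through 1 + u <= exp u. *)
  rewrite expRD ler_pM ?exprn_ge0 ?(ltW q0) ?(le_trans ler01 D1) //.
    rewrite mulrC expRM_natl lerXn2r ?nnegrE ?expR_ge0 ?(ltW q0) //.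
    exact: expR_ge1Dx.
  apply: (@le_trans _ _ (expR (10 * E) ^+ n)).
    by rewrite lerXn2r ?nnegrE ?expR_ge0 ?(le_trans ler01 D1) ?expR_ge1Dx.
  rewrite -expRM_natl ler_expR mulrCA.
  suff h (u v : R) : u <= v -> v <= 1 / 10000 -> 10 * u <= 1 by exact: h nE Lsmall.
  by clear; lra.
have l1 : 0 <= ln l%:R :> R by rewrite ln_ge0 // ler1n (leq_trans _ hs).
have lL : 0 <= 25%:R * L * l%:R by rewrite !mulr_ge0.
(* [ln] takes the value 0 at nonpositive arguments, and the right-hand side is nonnegative. *)
have [Q0|Q0] := ltP 0 Q; last by rewrite ln0 // !addr_ge0.
rewrite (@le_trans _ _ (25%:R * L * l%:R + 1)) //.
  by rewrite -[leRHS]expRK ler_ln // posrE expR_gt0.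
by rewrite lerD ?lerDl // ler1n.
Qed.
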